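(* Let $w^k\in\mathbb R^{n_1}\times\cdots\times\mathbb R^{n_p}\times\mathbb R^m$, $\xi^k=Pw^k$, and let $\tilde w^k\in\Omega$, $\tilde\xi^k=P\tilde w^k$, satisfy $$\theta(x)-\theta(\tilde x^k)+(w-\tilde w^k)^TF(\tilde w^k)\ \ge\ (\xi-\tilde\xi^k)^T\mathcal Q(\xi^k-\tilde\xi^k)\qquad\forall\, w\in\Omega\ (\xi=Pw),$$ where $\mathcal Q\in\mathbb R^{(p+1)m\times(p+1)m}$ and $\mathcal Q^T+\mathcal Q$ is positive definite. Let $\xi^{k+1}=\xi^k-\mathcal M(\xi^k-\tilde\xi^k)$ with $\mathcal M\in\mathbb R^{(p+1)m\times(p+1)m}$ non-singular. If there is a positive definite matrix $\mathcal H\in\mathbb R^{(p+1)m\times(p+1)m}$ such that $$\mathcal H\mathcal M=\mathcal Q\qquad\text{and}\qquad\mathcal G:=\mathcal Q^T+\mathcal Q-\mathcal M^T\mathcal H\mathcal M\succ0,$$ then $$\|\xi^{k+1}-\xi^*\|_{\mathcal H}^2\le\|\xi^k-\xi^*\|_{\mathcal H}^2-\|\xi^k-\tilde\xi^k\|_{\mathcal G}^2\qquad\forall\,\xi^*\in\Xi^*.$$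
   Context: Problem: $\min\{\sum_{i=1}^p\theta_i(x_i)\mid\sum_{i=1}^pA_ix_i=b\ (\text{or }\ge b),\ x_i\in\mathcal X_i\}$, where $p$ is a positive integer, $\theta_i:\mathbb R^{n_i}\to\mathbb R$ are closed proper convex functions (not necessarily smooth), $\mathcal X_i\subseteq\mathbb R^{n_i}$ are closed convex sets, $A_i\in\mathbb R^{m\times n_i}$ ($i=1,\dots,p$), $b\in\mathbb R^m$. Put $\Lambda=\mathbb R^m$ in the equality case and $\Lambda=\mathbb R^m_+$ in the inequality case, $\Omega=\prod_{i=1}^p\mathcal X_i\times\Lambda$. Write $w=(x_1,\dots,x_p,\lambda)$, $x=(x_1,\dots,x_p)$, $\theta(x)=\sum_{i=1}^p\theta_i(x_i)$, $F(w)=(-A_1^T\lambda,\dots,-A_p^T\lambda,\ \sum_{i=1}^pA_ix_i-b)$. $\Omega^*$ is the set of all $w^*\in\Omega$ with $\theta(x)-\theta(x^* )+(w-w^* )^TF(w^* )\ge0$ for all $w\in\Omega$. Tildes and superscripts carry over to components. For fixed $\beta>0$, $P=\mathrm{diag}(\sqrt\beta A_1,\dots,\sqrt\beta A_p,\frac1{\sqrt\beta}I_m)$ (block diagonal), $\xi=Pw\in\mathbb R^{(p+1)m}$, $\Xi^*=\{Pw^*\mid w^*\in\Omega^*\}$. Positive definite (written $\succ0$) means symmetric positive definite, and $\|v\|^2_{\mathcal H}=v^T\mathcal Hv$. *)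

(* Defs.v *)
From HB Require Import structures.
From mathcomp Require Import all_boot all_order all_algebra.
From mathcomp Require Import boolp classical_sets reals.
From mathcomp Require Import ereal topology normedtype convex.

Set Implicit Arguments.
Unset Strict Implicit.
Unset Printing Implicit Defensive.

Import Order.TTheory GRing.Theory Num.Theory.
Import numFieldNormedType.Exports.

Local Open Scope classical_set_scope.
Local Open Scope ring_scope.

Definition dotv (R : realType) (d : nat) (u v : 'cV[R]_d) : R :=
  (u^T *m v) 0 0.

(* ||v||_H^2; only a squared norm when H is positive definite. *)
Definition sqnorm (R : realType) (d : nat) (H : 'M[R]_d) (v : 'cV[R]_d) : R :=
  dotv v (H *m v).

Definition posdef (R : realType) (d : nat) (H : 'M[R]_d) : Prop :=
  H^T = H /\ forall v : 'cV[R]_d, v != 0 -> 0 < sqnorm H v.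

Definition proper_function (R : realType) (T : Type) (f : T -> \bar R) : Prop :=
  (exists x, (f x < +oo)%E) /\ (forall x, (-oo < f x)%E).

(* "Closed" means lower semicontinuous. *)
Definition closed_proper_convex (R : realType) (d : nat)
    (f : 'cV[R]_d -> R) : Prop :=
  [/\ lower_semicontinuous (EFin \o f),
      proper_function (EFin \o f) &
      convex_function setT f].

(* EqConstraint: sum_i A_i x_i = b;  GeConstraint: sum_i A_i x_i >= b. *)
Inductive constraint_kind := EqConstraint | GeConstraint.

Definition Lambda (R : realType) (m : nat) (c : constraint_kind) :
    set 'cV[R]_m :=
  match c with
  | EqConstraint => setT
  | GeConstraint => [set l | forall j, 0 <= l j 0]
  end.

(* w = (x_1, ..., x_p, lambda) is stacked into one column. *)
Definition xpart (R : realType) (p m : nat) (n : 'I_p -> nat)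
    (w : 'cV[R]_(\sum_(i < p) n i + m)) (i : 'I_p) : 'cV[R]_(n i) :=
  submxcol (usubmx w) i.

Definition lpart (R : realType) (p m : nat) (n : 'I_p -> nat)
    (w : 'cV[R]_(\sum_(i < p) n i + m)) : 'cV[R]_m :=
  dsubmx w.

Definition Omega (R : realType) (p m : nat) (n : 'I_p -> nat)
    (X : forall i, set 'cV[R]_(n i)) (c : constraint_kind) :
    set 'cV[R]_(\sum_(i < p) n i + m) :=
  [set w | (forall i, X i (xpart w i)) /\ Lambda c (lpart w)].

(* theta(x) as a function of w; it ignores the lambda component. *)
Definition thetasum (R : realType) (p m : nat) (n : 'I_p -> nat)
    (theta : forall i, 'cV[R]_(n i) -> R)
    (w : 'cV[R]_(\sum_(i < p) n i + m)) : R :=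
  \sum_(i < p) theta i (xpart w i).

Definition Fmap (R : realType) (p m : nat) (n : 'I_p -> nat)
    (A : forall i, 'M[R]_(m, n i)) (b : 'cV[R]_m)
    (w : 'cV[R]_(\sum_(i < p) n i + m)) : 'cV[R]_(\sum_(i < p) n i + m) :=
  col_mx (\mxcol_(i < p) (- (A i)^T *m lpart w))
         (\sum_(i < p) A i *m xpart w i - b).

Definition Omegastar (R : realType) (p m : nat) (n : 'I_p -> nat)
    (theta : forall i, 'cV[R]_(n i) -> R) (X : forall i, set 'cV[R]_(n i))
    (A : forall i, 'M[R]_(m, n i)) (b : 'cV[R]_m) (c : constraint_kind) :
    set 'cV[R]_(\sum_(i < p) n i + m) :=
  [set ws | Omega X c ws /\
     forall w, Omega X c w ->
       0 <= thetasum theta w - thetasum theta ws + dotv (w - ws) (Fmap A b ws)].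

Lemma xi_dimE (p m : nat) : (\sum_(i < p) m + m = p.+1 * m)%N.
Proof. by rewrite sum_nat_const card_ord mulSn addnC. Qed.

(* The block diagonal matrix P has p row blocks of height m above a last one,
   hence the cast of its height to (p + 1) m. *)
Definition Pmx (R : realType) (p m : nat) (n : 'I_p -> nat)
    (A : forall i, 'M[R]_(m, n i)) (beta : R) :
    'M[R]_(p.+1 * m, \sum_(i < p) n i + m) :=
  castmx (xi_dimE p m, erefl)
    (block_mx
      (\mxblock_(i < p, j < p)
         (if i == j then Num.sqrt beta *: A j else (0 : 'M[R]_(m, n j))))
      0
      0 (Num.sqrt beta)^-1%:M).

Definition Xistar (R : realType) (p m : nat) (n : 'I_p -> nat)
    (theta : forall i, 'cV[R]_(n i) -> R) (X : forall i, set 'cV[R]_(n i))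
    (A : forall i, 'M[R]_(m, n i)) (b : 'cV[R]_m) (c : constraint_kind)
    (beta : R) : set 'cV[R]_(p.+1 * m) :=
  [set Pmx A beta *m ws | ws in Omegastar theta X A b c].

(* Main.v *)
(** The predictor inequality at [w*], the variational inequality for [w*] at the
    predictor, and the monotonicity of [F] (whose linear part is skew) combine to
    [(xi~ - xi* )^T Q (xi^k - xi~) >= 0]. Since [H M = Q], expanding the [H]-norm of
    [xi^k - xi* - M (xi^k - xi~)] turns this into the claimed contraction. *)

Require Import Defs.
From HB Require Import structures.
From mathcomp Require Import all_boot all_order all_algebra.
From mathcomp Require Import boolp classical_sets reals.
From mathcomp Require Import ereal topology normedtype convex.
From mathcomp Require Import ring lra.

Set Implicit Arguments.
Unset Strict Implicit.
Unset Printing Implicit Defensive.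

Import Order.TTheory GRing.Theory Num.Theory.
Import numFieldNormedType.Exports.

Local Open Scope classical_set_scope.
Local Open Scope ring_scope.

Section DotProduct.

Variables (R : realType) (d : nat).
Implicit Types (u v w : 'cV[R]_d).

Lemma dotvC u v : dotv u v = dotv v u.
Proof. by rewrite /dotv -[u^T *m v]trmxK trmx_mul trmxK mxE. Qed.

Lemma dotvDl u v w : dotv (u + v) w = dotv u w + dotv v w.
Proof. by rewrite /dotv linearD mulmxDl mxE. Qed.

Lemma dotvDr u v w : dotv u (v + w) = dotv u v + dotv u w.
Proof. by rewrite /dotv mulmxDr mxE. Qed.

Lemma dotvNl u v : dotv (- u) v = - dotv u v.
Proof. by rewrite /dotv linearN mulNmx mxE. Qed.

Lemma dotvNr u v : dotv u (- v) = - dotv u v.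
Proof. by rewrite /dotv mulmxN mxE. Qed.

Lemma dotvBl u v w : dotv (u - v) w = dotv u w - dotv v w.
Proof. by rewrite dotvDl dotvNl. Qed.

Lemma dotvBr u v w : dotv u (v - w) = dotv u v - dotv u w.
Proof. by rewrite dotvDr dotvNr. Qed.

Lemma dotv_sumr (I : finType) u (f : I -> 'cV[R]_d) :
  dotv u (\sum_i f i) = \sum_i dotv u (f i).
Proof. by rewrite /dotv mulmx_sumr summxE. Qed.

End DotProduct.

Lemma dotv_trmx (R : realType) (d e : nat) (A : 'M[R]_(d, e)) u v :
  dotv u (A^T *m v) = dotv (A *m u) v.
Proof. by rewrite /dotv trmx_mul mulmxA. Qed.

Lemma dotv_col_mx (R : realType) (d e : nat) (u v : 'cV[R]_d)
    (u' v' : 'cV[R]_e) :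
  dotv (col_mx u u') (col_mx v v') = dotv u v + dotv u' v'.
Proof. by rewrite /dotv tr_col_mx mul_row_col mxE. Qed.

Lemma dotv_mxcol (R : realType) (p : nat) (n : 'I_p -> nat)
    (u v : forall i, 'cV[R]_(n i)) :
  dotv (\mxcol_i u i) (\mxcol_i v i) = \sum_i dotv (u i) (v i).
Proof. by rewrite /dotv tr_mxcol mul_mxrow_mxcol summxE. Qed.

(** Symmetry of [H] makes the two mixed terms equal, hence the factor 2. This expands the correction
    step in the [H]-norm. *)
Lemma sqnormB (R : realType) (d : nat) (H : 'M[R]_d) (u v : 'cV[R]_d) :
  H^T = H ->
  sqnorm H (u - v) = sqnorm H u - dotv u (H *m v) *+ 2 + sqnorm H v.
Proof.
move=> symH; rewrite /sqnorm mulmxBr !dotvBl !dotvBr.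
have -> : dotv v (H *m u) = dotv u (H *m v) by rewrite -{1}symH dotv_trmx dotvC.
by ring.
Qed.

Section SkewSymmetry.

Variables (R : realType) (p m : nat) (n : 'I_p -> nat).
Variables (A : forall i : 'I_p, 'M[R]_(m, n i)) (b : 'cV[R]_m).
Implicit Types v w : 'cV[R]_(\sum_(i < p) n i + m).

(** Up to the [b] term, the pairing is a bilinear form that changes sign when [w] and [v] are
    swapped: the blocks [A i] and [- (A i)^T] of [Fmap] mirror each other. *)
Lemma dotv_Fmap w v :
  dotv w (Fmap A b v) =
  \sum_i (dotv (lpart w) (A i *m xpart v i) -
          dotv (A i *m xpart w i) (lpart v)) - dotv (lpart w) b.
Proof.
(* Only the left argument is rebuilt from its blocks, to face the block column [Fmap A b v]. *)
rewrite -{1}[w]vsubmxK -{1}[usubmx w]submxcolK /Fmap dotv_col_mx dotv_mxcol.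
rewrite dotvBr dotv_sumr addrA -big_split /=; congr (_ - _).
by apply: eq_bigr => i _; rewrite mulNmx dotvNr dotv_trmx addrC.
Qed.

Lemma xpartB w v i : xpart (w - v) i = xpart w i - xpart v i.
Proof. by rewrite /xpart linearB submxcolB. Qed.

Lemma lpartB w v : lpart (w - v) = lpart w - lpart v.
Proof. by rewrite /lpart linearB. Qed.

(** The two sides differ by the skew form evaluated at [w - v] twice, which is zero; the constant
    [b] cancels. Monotonicity of the affine map thus holds with equality. *)
Lemma dotv_FmapB w v : dotv (w - v) (Fmap A b w) = dotv (w - v) (Fmap A b v).
Proof.
apply/eqP; rewrite -subr_eq0 !dotv_Fmap opprB addrA subrK -sumrB.
rewrite big1 // => i _; rewrite xpartB lpartB mulmxBr !dotvBl.
rewrite ![dotv (A i *m _) _]dotvC; ring.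
Qed.

End SkewSymmetry.

Theorem theorem6p1 (R : realType) (p m : nat) (n : 'I_p -> nat)
    (theta : forall i : 'I_p, 'cV[R]_(n i) -> R)
    (X : forall i : 'I_p, set 'cV[R]_(n i))
    (A : forall i : 'I_p, 'M[R]_(m, n i)) (b : 'cV[R]_m)
    (c : constraint_kind) (beta : R)
    (hp : (0 < p)%N)
    (htheta : forall i : 'I_p, closed_proper_convex (theta i))
    (hXclosed : forall i : 'I_p, closed (X i))
    (hXconvex : forall i : 'I_p, convex_set (X i))
    (hbeta : 0 < beta)
    (wk wt : 'cV[R]_(\sum_(i < p) n i + m))
    (xik xit xik1 : 'cV[R]_(p.+1 * m))
    (Q M : 'M[R]_(p.+1 * m))
    (hxik : xik = Pmx A beta *m wk)
    (hwt : Omega X c wt)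
    (hxit : xit = Pmx A beta *m wt)
    (hQ : posdef (Q^T + Q))
    (hpred : forall w : 'cV[R]_(\sum_(i < p) n i + m), Omega X c w ->
       dotv (Pmx A beta *m w - xit) (Q *m (xik - xit)) <=
       thetasum theta w - thetasum theta wt + dotv (w - wt) (Fmap A b wt))
    (hM : M \in unitmx)
    (hxik1 : xik1 = xik - M *m (xik - xit)) :
  forall H : 'M[R]_(p.+1 * m),
    posdef H ->
    H *m M = Q ->
    posdef (Q^T + Q - M^T *m H *m M) ->
    forall xis : 'cV[R]_(p.+1 * m), Xistar theta X A b c beta xis ->
      sqnorm H (xik1 - xis) <=
      sqnorm H (xik - xis) - sqnorm (Q^T + Q - M^T *m H *m M) (xik - xit).
Proof.
move=> H [symH _] HM _ xis [ws [ws_Omega ws_VI] <-].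
set xis' := Pmx A beta *m ws; set e := xik - xit.
have cross : 0 <= dotv (xit - xis') (Q *m e).
  rewrite -opprB dotvNl oppr_ge0.
  (* Each inequality is tested at the other's point. Once [Fmap] is moved from [ws] to [wt], adding
     them cancels both the [thetasum] and the [Fmap] terms. *)
  have := hpred ws ws_Omega; have := ws_VI wt hwt.
  rewrite -dotv_FmapB -(opprB ws wt) dotvNl -/xis' -/e; lra.
have -> : xik1 - xis' = (xik - xis') - M *m e by rewrite hxik1 addrAC.
have splitx : xik - xis' = e + (xit - xis') by rewrite /e addrA subrK.
have normM : sqnorm H (M *m e) = sqnorm (M^T *m H *m M) e.
  by rewrite /sqnorm -!mulmxA dotv_trmx.
(* [Q] need not be symmetric, but [Q^T] and [Q] give the same quadratic form, so their sum counts
   [dotv e (Q *m e)] twice. *)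
have normG : sqnorm (Q^T + Q - M^T *m H *m M) e =
    dotv e (Q *m e) *+ 2 - sqnorm (M^T *m H *m M) e.
  rewrite /sqnorm mulmxBl mulmxDl dotvBr dotvDr dotv_trmx.
  by rewrite [dotv (Q *m e) e]dotvC mulr2n.
rewrite [sqnorm H (_ - M *m e)]sqnormB // [H *m (M *m e)]mulmxA HM.
(* Only the mixed term is split along [splitx]. Its [e] part completes the [G]-norm, and the gap
   left between the two sides is exactly twice the quantity in [cross]. *)
rewrite normM normG {2}splitx dotvDl; lra.
Qed.
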